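(* Let $k>0$ and $p\in\mathcal{P}$. For $0\leq\xi<1$ define $$\varphi_\xi:\mathcal{R}\rightarrow\mathcal{R},\quad x\mapsto\xi\cdot x+(1-\xi)\cdot elo_k^{cl}(x,p),$$ and put $G:=\frac{k\cdot(n-1)}{4}\cdot\max_{i,j\in n}(p_{ij}+p_{ji})\geq 0$. (i) There exists one and only one self-justifying rating $x\in\mathcal{R}$ with respect to $p$ and $k$. (ii) For every $0\leq\xi<1$, the self-justifying rating with respect to $p$ and $k$ is the unique fixed point of $\varphi_\xi$. (iii) Let $\frac{G}{G+1}\leq\xi<1$. Then $\varphi_\xi$ is a contraction with contraction factor $\xi$, i.e. $\lVert\varphi_\xi(z)-\varphi_\xi(y)\rVert_1\leq\xi\cdot\lVert z-y\rVert_1$ for all $y,z\in\mathcal{R}$. (iv) Let $\frac{G}{G+1}\leq\xi<1$ and $y\in\mathcal{R}$. Then the sequence $(\varphi_\xi^l(y))_{l\in\mathbb{N}}$ (where $\varphi_\xi^l$ is the $l$-fold iterate of $\varphi_\xi$) converges to the self-justifying rating $x$ with respect to $p$ and $k$. For all $l\in\mathbb{N}$, $$\lVert\varphi_\xi^l(y)-x\rVert_1\leq\xi^l\cdot\lVert y-x\rVert_1,$$ $$\lVert\varphi_\xi^l(y)-\varphi_\xi^{l+1}(y)\rVert_1\leq\xi^l\cdot\lVert y-\varphi_\xi(y)\rVert_1,$$ $$\lVert\varphi_\xi^l(y)-elo_k^{cl}(\varphi_\xi^l(y),p)\rVert_1\leq\xi^l\cdot\lVert y-elo_k^{cl}(y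,p)\rVert_1.$$
   Context: Fix $n\in\mathbb{N}$ with $n\geq 2$ and identify $n=\{0,1,\dots,n-1\}$ (so $i\in n$ means $0\le i\le n-1$). $\mathbb{N}$ includes $0$. The rating space is $\mathcal{R}:=\{x\in\mathbb{R}^n\mid\sum_{i\in n}x_i=0\}$, with norm $\lVert\cdot\rVert_1$. The space of competition results is $\mathcal{P}:=\{p\in\mathbb{R}^{n\times n}\mid p_{ij}\geq 0\text{ for all }i,j\in n,\ p_{ii}=0\text{ for all }i\in n\}$. For $k>0$, the classical Elo map is $$elo_k^{cl}:\mathcal{R}\times\mathcal{P}\rightarrow\mathcal{R},\quad (x,p)\mapsto k\cdot\left(\sum_{j\in n}\left(p_{ij}-\frac{p_{ij}+p_{ji}}{1+\exp(x_j-x_i)}\right)\right)_{i\in n}$$ (its values do lie in $\mathcal{R}$). A rating $x\in\mathcal{R}$ is self-justifying with respect to $p\in\mathcal{P}$ and $k>0$ if $x=elo_k^{cl}(x,p)$. *)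

(* Defs.v *)
From HB Require Import structures.
From mathcomp Require Import all_boot all_order all_algebra.
From mathcomp Require Import all_classical all_reals all_analysis.
From mathcomp Require Import ring.
Set Implicit Arguments.
Unset Strict Implicit.
Unset Printing Implicit Defensive.
Import Order.TTheory GRing.Theory Num.Theory.
Import numFieldNormedType.Exports.
Local Open Scope ring_scope.

Definition zero_sum (R : realType) (n : nat) : qualifier 1 'rV[R]_n :=
  [qualify a x : 'rV[R]_n | \sum_i x ord0 i == 0].

Lemma zero_sum_submod_closed (R : realType) (n : nat) :
  submod_closed (@zero_sum R n).
Proof.
split=> [|a x y]; rewrite !qualifE /=; first by rewrite big1// => i _; rewrite mxE.
move=> /eqP x0 /eqP y0; under eq_bigr do rewrite !mxE.
by rewrite big_split/= -mulr_sumr x0 y0 mulr0 addr0.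
Qed.

HB.instance Definition _ (R : realType) (n : nat) :=
  GRing.isSubmodClosed.Build R 'rV[R]_n
    (has_quality 1 (@zero_sum R n)) (@zero_sum_submod_closed R n).

Record rating (R : realType) (n : nat) : Type :=
  Rating { rating_val :> 'rV[R]_n ; _ : rating_val \is a @zero_sum R n }.

HB.instance Definition _ (R : realType) (n : nat) :=
  [isSub for @rating_val R n].
HB.instance Definition _ (R : realType) (n : nat) :=
  [Choice of rating R n by <:].
HB.instance Definition _ (R : realType) (n : nat) :=
  [SubChoice_isSubLmodule of rating R n by <:].

Definition norm1 (R : realType) (n : nat) (x : rating R n) : R :=
  \sum_i `|x ord0 i|.

Definition competition_result (R : realType) (n : nat) (p : 'M[R]_n) : Prop :=
  (forall i j, 0 <= p i j) /\ (forall i, p i i = 0).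

Definition elo_row (R : realType) (n : nat) (k : R) (x : 'rV[R]_n)
    (p : 'M[R]_n) : 'rV[R]_n :=
  k *: \row_i \sum_j (p i j - (p i j + p j i) / (1 + expR (x ord0 j - x ord0 i))).

Lemma elo_row_zero_sum (R : realType) (n : nat) (k : R) (x : 'rV[R]_n)
  (p : 'M[R]_n) : elo_row k x p \is a @zero_sum R n.
Proof.
rewrite qualifE /=; apply/eqP; under eq_bigr do rewrite !mxE.
rewrite -mulr_sumr; set S := (X in k * X); suff -> : S = 0 by rewrite mulr0.
have SE : S = \sum_i \sum_j
    (p j i - (p j i + p i j) / (1 + expR (x ord0 i - x ord0 j))).
  by rewrite /S exchange_big.
suff : S + S = 0.
  by move/eqP; rewrite -mulr2n mulrn_eq0 /= => /eqP.
rewrite {2}SE /S -big_split big1//= => i _; rewrite -big_split big1//= => j _.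
rewrite -(opprB (x ord0 j) (x ord0 i)) expRN.
have := expR_gt0 (x ord0 j - x ord0 i); set e := expR _ => e0.
by field; rewrite addrC !gt_eqF// addr_gt0.
Qed.

(* The formula makes sense, with values summing to 0, for any matrix p;
   membership of p in the space of competition results is a hypothesis of
   the statements about elo. *)
Definition elo (R : realType) (n : nat) (k : R) (x : rating R n)
    (p : 'M[R]_n) : rating R n :=
  Rating (elo_row_zero_sum k x p).

Definition self_justifying (R : realType) (n : nat) (k : R) (p : 'M[R]_n)
    (x : rating R n) : Prop :=
  x = elo k x p.

Definition elo_damped (R : realType) (n : nat) (k : R) (p : 'M[R]_n) (xi : R)
    (x : rating R n) : rating R n :=
  xi *: x + (1 - xi) *: elo k x p.

(* For a competition result p all the p i j + p j i are nonnegative, so the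
   default value 0 of the iterated maximum does not affect it. *)
Definition elo_bound (R : realType) (n : nat) (k : R) (p : 'M[R]_n) : R :=
  k * (n%:R - 1) / 4
    * \big[Num.max/0]_(ij : 'I_n * 'I_n) (p ij.1 ij.2 + p ij.2 ij.1).

(* Main.v *)
(** Writing [sigma] for the logistic function, the coordinates of [elo k x p]
    are [k * \sum_j (p i j - (p i j + p j i) * sigma (x i - x j))].  By the mean
    value theorem the difference quotients of [sigma] lie in [[0, 1/4]], and
    they are symmetric because [sigma (- t) = 1 - sigma t].  Hence
    [phi z - phi y = xi *: d - L d] with [d = z - y] and [L] the Laplacian of a
    symmetric nonnegative weight whose row sums are at most [(1 - xi) * G].
    When this is at most [xi], the matrix [xi - L] has nonnegative entries and
    column sums [xi], so it contracts the 1-norm by [xi].  The fixed points of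
    [phi] do not depend on [xi < 1], so existence and uniqueness follow from
    Banach's theorem for [xi = G / (G + 1)]. *)
Require Import Defs.
From mathcomp Require Import all_boot all_order all_algebra.
From mathcomp Require Import all_classical all_reals all_analysis.
From mathcomp Require Import ring lra.
Import Order.TTheory GRing.Theory Num.Theory.
Import numFieldNormedType.Exports.
Local Open Scope classical_set_scope.
Local Open Scope ring_scope.

(** * The logistic function and its difference quotients *)

Definition logistic {R : realType} (t : R) : R := (1 + expR (- t))^-1.

Section Logistic.
Variable R : realType.
Implicit Types a b t : R.

Lemma logisticN t : logistic (- t) = 1 - logistic t.
Proof.
rewrite /logistic opprK expRN; have := expR_gt0 t; set e := expR t => e0.
by field; rewrite !gt_eqF ?addr_gt0.
Qed.

Lemma logistic_le a b : a <= b -> logistic a <= logistic b.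
Proof.
move=> ab; rewrite /logistic lef_pV2 ?posrE ?addr_gt0 ?expR_gt0//.
by rewrite lerD2l ler_expR lerN2.
Qed.

Lemma is_derive_logistic t :
  is_derive t (1 : R) logistic (expR (- t) / (1 + expR (- t)) ^+ 2).
Proof.
have dN : is_derive t (1 : R) (expR \o -%R) (expR (- t) * - 1).
  exact: is_derive1_comp.
have de : is_derive t (1 : R) (fun u => 1 + expR (- u)) (- expR (- t)).
  have := is_deriveD (is_derive_cst (1 : R) t 1) dN.
  rewrite add0r mulrN1; exact.
have ne : 1 + expR (- t) != 0 by rewrite gt_eqF// addr_gt0// expR_gt0.
have := is_deriveV (f := fun u => 1 + expR (- u)) ne de.
by rewrite scaleNr scalerN opprK -[_ *: _]/(_ * _) mulrC.
Qed.

(** With [e = expR (- t)] the derivative is [e / (1 + e) ^+ 2], and [4 * e <= (1 + e) ^+ 2] because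
    [(1 - e) ^+ 2] is nonnegative. *)
Lemma logistic_slope_le a b : a <= b -> logistic b - logistic a <= (b - a) / 4.
Proof.
move=> ab.
have [|t _ ->] := MVT_segment ab (fun t _ => is_derive_logistic t).
  by apply: derivable_within_continuous => t _; case: (is_derive_logistic t).
rewrite mulrC ler_wpM2l ?subr_ge0//.
have := expR_gt0 (- t); set e := expR _ => e0.
rewrite ler_pdivrMr ?exprn_gt0 ?addr_gt0//.
have := sqr_ge0 (1 - e); nra.
Qed.

(* Junk value 0 at [a = b]. *)
Definition logistic_slope a b : R := (logistic b - logistic a) / (b - a).

Lemma logistic_slopeK a b :
  logistic_slope a b * (b - a) = logistic b - logistic a.
Proof.
rewrite /logistic_slope; have [->|ab] := eqVneq b a.
  by rewrite !subrr mulr0.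
by rewrite divfK// subr_eq0.
Qed.

(** Swapping two players negates both rating differences, so this invariance makes the Laplacian
    weights symmetric. *)
Lemma logistic_slopeN a b : logistic_slope (- a) (- b) = logistic_slope a b.
Proof.
rewrite /logistic_slope !logisticN -opprD invrN mulrN -mulNr.
by congr (_ / _); ring.
Qed.

Lemma logistic_slopeC a b : logistic_slope a b = logistic_slope b a.
Proof. by rewrite /logistic_slope -[b - a]opprB invrN mulrN -mulNr opprB. Qed.

Lemma logistic_slope_itv a b : 0 <= logistic_slope a b <= 1 / 4.
Proof.
wlog ab : a b / a < b.
  move=> H; have [/H//|/H|->] := ltgtP a b; first by rewrite logistic_slopeC.
  (* At [a = b] the default value 0 lies in the interval as well. *)
  by rewrite /logistic_slope !subrr mul0r lexx divr_ge0.
rewrite /logistic_slope divr_ge0 ?subr_ge0 ?logistic_le ?(ltW ab)//=.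
by rewrite ler_pdivrMr ?subr_gt0// mulrC mul1r logistic_slope_le// ltW.
Qed.

End Logistic.

Arguments logistic_slope {R} a b.

(** The matrix applied to [d] has nonnegative entries and, by symmetry of [w], column sums [a]; the
    triangle inequality in each row then suffices. *)
Lemma laplacian_norm1_le (R : realDomainType) (I : finType) (a : R)
    (w : I -> I -> R) (d : I -> R) :
    (forall i j, 0 <= w i j) -> (forall i j, w i j = w j i) ->
    (forall i, \sum_j w i j <= a) ->
  \sum_i `|a * d i - \sum_j w i j * (d i - d j)| <= a * \sum_i `|d i|.
Proof.
move=> w0 wC wa; rewrite mulr_sumr.
have rowE i : a * d i - \sum_j w i j * (d i - d j) =
    (a - \sum_j w i j) * d i + \sum_j w i j * d j.
  rewrite mulrBl -addrA; congr (_ + _); rewrite addrC.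
  by under eq_bigr do rewrite mulrBr; rewrite sumrB opprB mulr_suml addrC.
apply: (@le_trans _ _
    (\sum_i ((a - \sum_j w i j) * `|d i| + \sum_j w i j * `|d j|))).
  apply: ler_sum => i _; rewrite rowE (le_trans (ler_normD _ _))// lerD//.
    by rewrite normrM ger0_norm// subr_ge0.
  rewrite (le_trans (ler_norm_sum _ _ _))// ler_sum// => j _.
  by rewrite normrM ger0_norm.
(* After exchanging the sums, [|d i|] has coefficient [a - \sum_j w i j + \sum_j w j i], which is
   [a] by symmetry. *)
rewrite big_split exchange_big -big_split/= ler_sum// => i _.
by rewrite -mulr_suml -mulrDl (eq_bigr _ (fun j _ => wC j i)) subrK.
Qed.

(** * The 1-norm on ratings and Banach's fixed point theorem *)

Section Norm1.
Variables (R : realType) (n : nat).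
Implicit Types (x y z : rating R n) (f : rating R n -> rating R n).

Lemma ratingDE x y i : (x + y : rating R n) ord0 i = x ord0 i + y ord0 i.
Proof. by rewrite [rating_val _](raddfD \val) mxE. Qed.

Lemma ratingZE a x i : (a *: x : rating R n) ord0 i = a * x ord0 i.
Proof. by rewrite [rating_val _](linearZZ (\val : rating R n -> _)) mxE. Qed.

Lemma ratingBE x y i : (x - y : rating R n) ord0 i = x ord0 i - y ord0 i.
Proof. by rewrite -scaleN1r ratingDE ratingZE mulN1r. Qed.

Lemma norm1_ge0 x : 0 <= norm1 x.
Proof. by apply: sumr_ge0. Qed.

Lemma ler_norm1D x y : norm1 (x + y) <= norm1 x + norm1 y.
Proof.
rewrite /norm1 -big_split ler_sum// => i _.
by rewrite ratingDE ler_normD.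
Qed.

Lemma norm1Z a x : norm1 (a *: x) = `|a| * norm1 x.
Proof.
rewrite /norm1 mulr_sumr; apply: eq_bigr => i _.
by rewrite ratingZE normrM.
Qed.

Lemma norm1N x : norm1 (- x) = norm1 x.
Proof. by rewrite -scaleN1r norm1Z normrN1 mul1r. Qed.

Lemma norm1_coord x i : `|x ord0 i| <= norm1 x.
Proof. by rewrite /norm1 (bigD1 i)//= lerDl sumr_ge0. Qed.

Lemma norm1_eq0 x : norm1 x = 0 -> x = 0.
Proof.
move=> x0; apply/val_inj/rowP => i; rewrite raddf0 mxE.
by apply/eqP; rewrite -normr_le0 -x0 norm1_coord.
Qed.


Lemma iter_contraction f (q : R) (l : nat) x y :
    0 <= q -> (forall y z, norm1 (f z - f y) <= q * norm1 (z - y)) ->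
  norm1 (iter l f x - iter l f y) <= q ^+ l * norm1 (x - y).
Proof.
move=> q0 fq; elim: l => [|l IHl]; first by rewrite expr0 mul1r.
by rewrite !iterS (le_trans (fq _ _))// exprS -mulrA ler_wpM2l.
Qed.

(** The orbit of 0 converges in each coordinate, as its increments are dominated by a geometric
    series; the limits form a rating, and it is fixed by [f]. *)
Lemma contraction_fixpoint f (q : R) :
    0 <= q -> q < 1 ->
    (forall y z, norm1 (f z - f y) <= q * norm1 (z - y)) ->
  exists x, f x = x.
Proof.
move=> q0 q1 fq; pose u l := iter l f 0.
have qn : `|q| < 1 by rewrite ger0_norm.
have uq l : norm1 (u l.+1 - u l) <= norm1 (f 0) * q ^+ l.
  rewrite /u iterSr (le_trans (iter_contraction f q l (f 0) 0 q0 fq))//.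
  by rewrite subr0 mulrC.
pose c i l : R := u l ord0 i.
have cv i : cvgn (c i).
  have -> : c i = (fun l => c i 0%N + series (telescope (c i)) l).
    by apply/funext => l; exact: eq_sum_telescope.
  apply: is_cvgD; first exact: is_cvg_cst.
  apply: normed_cvg.
  apply: (series_le_cvg _ _ _ (is_cvg_geometric_series (a := norm1 (f 0)) qn)).
  - by move=> l; exact: normr_ge0.
  - by move=> l; rewrite /geometric/= mulr_ge0 ?norm1_ge0 ?exprn_ge0.
  - move=> l; rewrite /= (le_trans _ (uq l))//.
    by have := norm1_coord (u l.+1 - u l) i; rewrite ratingBE.
pose v : 'rV[R]_n := \row_i limn (c i).
have v0 : v \is a @zero_sum R n.
  rewrite qualifE /=; apply/eqP; under eq_bigr do rewrite mxE.
  (* A finite sum of limits is the limit of the sums, which are constantly 0. *)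
  have sc : (fun l => \sum_i c i l) @ \oo --> \sum_i limn (c i).
    by apply: cvg_big => [|i _]; [exact: add_continuous|exact: cv].
  rewrite -(cvg_lim _ sc)//.
  have -> : (fun l => \sum_i c i l) = (fun=> 0).
    apply/funext => l; rewrite /c; case: (u l) => w /=.
    by rewrite qualifE => /eqP.
  by rewrite lim_cst.
pose x := Rating v0; exists x.
have ux : (fun l => norm1 (u l - x)) @ \oo --> (0 : R).
  have nc i : (fun l => `|(u l - x : rating R n) ord0 i|) @ \oo --> `|0 : R|.
    apply: cvg_norm; under eq_fun do rewrite ratingBE mxE.
    by rewrite -(subrr (limn (c i))); apply: cvgB; [exact: cv|exact: cvg_cst].
  have s0 : \sum_(i < n) `|0 : R| = 0 by rewrite big1// => i _; rewrite normr0.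
  rewrite -[X in _ --> X]s0 /norm1.
  by apply: cvg_big => [|i _]; [exact: add_continuous|exact: nc].
apply/subr0_eq/norm1_eq0/le_anti; rewrite norm1_ge0 andbT.
(* This null sequence bounds [norm1 (f x - x)] from above, by the triangle inequality through
   [u l.+1 = f (u l)]. *)
have ux2 : (fun l => q * norm1 (u l - x) + norm1 (u l.+1 - x)) @ \oo -->
    (0 : R).
  rewrite -[X in _ --> X](_ : q * 0 + 0 = 0); last by rewrite mulr0 addr0.
  apply: cvgD; first by apply: cvgM => //; exact: cvg_cst.
  by rewrite -(cvg_shiftS (fun l => norm1 (u l - x))) in ux.
rewrite -(cvg_lim _ ux2)//; apply: limr_ge; first by apply/cvg_ex; exists 0.
near=> l; rewrite (_ : f x - x = f x - u l.+1 + (u l.+1 - x)); last first.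
  by rewrite addrA subrK.
rewrite (le_trans (ler_norm1D _ _))// lerD2r.
by rewrite -[f x - _]opprB norm1N; exact: fq.
Unshelve. all: by end_near. Qed.

Lemma contraction_fixpoint_unique f (q : R) x y :
    q < 1 -> (forall y z, norm1 (f z - f y) <= q * norm1 (z - y)) ->
  f x = x -> f y = y -> x = y.
Proof.
move=> q1 fq fx fy; have := fq y x; rewrite fx fy => le_q.
apply/subr0_eq/norm1_eq0/le_anti; rewrite norm1_ge0 andbT.
by rewrite -(pmulr_rle0 _ (_ : 0 < 1 - q)) ?subr_gt0// mulrBl mul1r subr_le0.
Qed.

End Norm1.

(** * Fixed points and contraction of the damped Elo map *)

Section Elo.
Variables (R : realType) (n : nat) (k : R) (p : 'M[R]_n).
Hypotheses (n2 : (2 <= n)%N) (k_gt0 : 0 < k) (pP : competition_result p).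
Implicit Types x y z : rating R n.

Local Notation G := (elo_bound k p).

Lemma elo_coordE x i : elo k x p ord0 i =
  k * \sum_j (p i j - (p i j + p j i) * logistic (x ord0 i - x ord0 j)).
Proof.
by rewrite !mxE; congr (_ * _); apply: eq_bigr => j _; rewrite /logistic opprB.
Qed.

Lemma elo_bound_ge0 : 0 <= G.
Proof.
rewrite /elo_bound mulr_ge0 ?bigmax_ge_id// divr_ge0// mulr_ge0 ?(ltW k_gt0)//.
by rewrite subr_ge0 ler1n ltnW.
Qed.

(** The two defects differ by the factor [1 - xi]: this identifies the fixed points and later
    converts step estimates into estimates for [elo]. *)
Lemma sub_elo_damped xi x :
  x - elo_damped k p xi x = (1 - xi) *: (x - elo k x p).
Proof.
by rewrite /elo_damped scalerBr [(1 - xi) *: x]scalerBl scale1r opprD addrA.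
Qed.

Lemma elo_damped_fixE xi x :
  xi < 1 -> elo_damped k p xi x = x <-> self_justifying k p x.
Proof.
move=> xi1; have xi0 : 1 - xi != 0 by rewrite subr_eq0 gt_eqF.
split=> [dx|xE]; apply/eqP.
  have /eqP := sub_elo_damped xi x.
  by rewrite dx subrr eq_sym scaler_eq0 (negPf xi0)/= subr_eq0.
by rewrite eq_sym -subr_eq0 sub_elo_damped -xE subrr scaler0.
Qed.

Lemma elo_damped_contraction xi y z : G / (G + 1) <= xi -> xi < 1 ->
  norm1 (elo_damped k p xi z - elo_damped k p xi y) <= xi * norm1 (z - y).
Proof.
move=> Gxi xi1; have [p0 pd] := pP; have G0 := elo_bound_ge0.
(* The lower bound on [xi], rearranged into the bound needed for the row sums of [w]. *)
have xi_le : (1 - xi) * G <= xi.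
  by move: Gxi; rewrite ler_pdivrMr ?ltr_wpDl// => Gxi; lra.
pose s i j := p i j + p j i.
pose c i j := logistic_slope (y ord0 i - y ord0 j) (z ord0 i - z ord0 j).
pose w i j := (1 - xi) * (k * (s i j * c i j)).
have c_itv i j : 0 <= c i j <= 1 / 4 by exact: logistic_slope_itv.
have s0 i j : 0 <= s i j by rewrite addr_ge0.
have w0 i j : 0 <= w i j.
  have /andP[c0 _] := c_itv i j.
  by rewrite mulr_ge0 ?subr_ge0 ?(ltW xi1)// mulr_ge0 ?(ltW k_gt0)// mulr_ge0.
have wC i j : w i j = w j i.
  by rewrite /w /c -logistic_slopeN !opprB /s [p i j + _]addrC.
have wxi i : \sum_j w i j <= xi.
  apply: le_trans xi_le; rewrite -mulr_sumr ler_wpM2l ?subr_ge0 ?(ltW xi1)//.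
  rewrite -mulr_sumr /elo_bound.
  set M := \big[Num.max/_]_(_ | _) _.
  rewrite -!mulrA ler_wpM2l ?(ltW k_gt0)//.
  have sM j : s i j * c i j <= M / 4.
    have /andP[c0 c4] := c_itv i j.
    rewrite -div1r ler_pM//.
    exact: (le_bigmax _
      (fun ij : 'I_n * 'I_n => p ij.1 ij.2 + p ij.2 ij.1) (i, j)).
  (* The diagonal term vanishes since [p i i = 0]; the [n - 1] remaining terms give the factor
     [n - 1] in [G]. *)
  rewrite (bigD1 i)//= /s pd addr0 mul0r add0r.
  apply: le_trans (ler_sum _ (fun j _ => sM j)) _.
  rewrite sumr_const cardC1 card_ord -[_ *+ _]mulr_natl.
  by rewrite -subn1 natrB ?(ltnW n2)// [4^-1 * M]mulrC.
pose d i := z ord0 i - y ord0 i.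
have -> : norm1 (z - y) = \sum_i `|d i|.
  by apply: eq_bigr => i _; rewrite ratingBE.
apply: le_trans (laplacian_norm1_le _ _ xi w d w0 wC wxi).
rewrite le_eqVlt; apply/orP; left; apply/eqP/eq_bigr => i _; congr `|_|.
rewrite ratingBE /elo_damped !ratingDE !ratingZE !elo_coordE.
(* The terms [p i j] cancel, and [logistic_slopeK] writes each difference of logistic values as
   [c i j] times [d i - d j]. *)
have -> : \sum_j w i j * (d i - d j) =
    (1 - xi) * (k * (\sum_j (p i j - s i j * logistic (y ord0 i - y ord0 j)) -
                     \sum_j (p i j - s i j * logistic (z ord0 i - z ord0 j)))).
  rewrite -sumrB !mulr_sumr; apply: eq_bigr => j _.
  rewrite /w -3!mulrA; congr (_ * (_ * _)).
  rewrite [RHS](_ : _ = s i j * (logistic (z ord0 i - z ord0 j) -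
                             logistic (y ord0 i - y ord0 j))); last by ring.
  by rewrite -logistic_slopeK /d; congr (_ * (_ * _)); ring.
by rewrite /d /s; ring.
Qed.

End Elo.

Theorem theorem3p3 (R : realType) (n : nat) (hn : (2 <= n)%N) (k : R)
    (hk : 0 < k) (p : 'M[R]_n) (hp : competition_result p) :
  let phi := elo_damped k p in
  let G := elo_bound k p in
  0 <= G /\
  (* (i) *)
  (exists! x : rating R n, self_justifying k p x) /\
  (* (ii) *)
  (forall xi : R, 0 <= xi -> xi < 1 ->
    forall x : rating R n, self_justifying k p x ->
      unique (fun y : rating R n => phi xi y = y) x) /\
  (* (iii) *)
  (forall xi : R, G / (G + 1) <= xi -> xi < 1 ->
    forall y z : rating R n,
      norm1 (phi xi z - phi xi y) <= xi * norm1 (z - y)) /\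
  (* (iv) *)
  (forall xi : R, G / (G + 1) <= xi -> xi < 1 ->
    forall y x : rating R n, self_justifying k p x ->
      (fun l : nat => norm1 (iter l (phi xi) y - x)) @ \oo --> (0 : R) /\
      forall l : nat,
        [/\ norm1 (iter l (phi xi) y - x) <= xi ^+ l * norm1 (y - x),
            norm1 (iter l (phi xi) y - iter l.+1 (phi xi) y)
              <= xi ^+ l * norm1 (y - phi xi y)
          & norm1 (iter l (phi xi) y - elo k (iter l (phi xi) y) p)
              <= xi ^+ l * norm1 (y - elo k y p)]).
Proof.
have G0 : 0 <= elo_bound k p by exact: elo_bound_ge0.
have contr := elo_damped_contraction _ _ _ _ hn hk hp.
have G1 : elo_bound k p / (elo_bound k p + 1) < 1.
  by rewrite ltr_pdivrMr ?ltr_wpDl// mul1r ltrDl.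
have xi_ge0 xi : elo_bound k p / (elo_bound k p + 1) <= xi -> 0 <= xi.
  by apply: le_trans; rewrite divr_ge0// addr_ge0.
have [x0 x0P] : exists x, self_justifying k p x.
  have [x xP] := contraction_fixpoint _ _ _ _ (xi_ge0 _ (lexx _)) G1
    (fun y z => contr _ y z (lexx _) G1).
  by exists x; apply/(elo_damped_fixE _ _ _ _ _ _ G1).
have uniq_sj x y : self_justifying k p x -> self_justifying k p y -> x = y.
  move=> /(elo_damped_fixE _ _ _ _ _ _ G1) xP.
  move=> /(elo_damped_fixE _ _ _ _ _ _ G1) yP.
  apply: (contraction_fixpoint_unique _ _ _ _ _ _ G1 _ xP yP) => u v.
  exact: contr.
split=> //; split; first by exists x0; split=> // y; exact: uniq_sj.
split.
  (* Here [xi] may lie below [G / (G + 1)]; uniqueness carries over because the fixed points are the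
     same for all [xi < 1]. *)
  move=> xi _ xi1 x xP; split; first exact/elo_damped_fixE.
  by move=> y /elo_damped_fixE -/(_ xi1); exact: uniq_sj.
split=> [xi Gxi xi1 y z|xi Gxi xi1 y x xP]; first exact: contr.
set f := elo_damped k p xi.
have fq u v : norm1 (f v - f u) <= xi * norm1 (v - u) by exact: contr.
have xi0 := xi_ge0 _ Gxi.
have fx l : iter l f x = x by rewrite iter_fix//; exact/elo_damped_fixE.
have le_x l : norm1 (iter l f y - x) <= xi ^+ l * norm1 (y - x).
  by rewrite -{1}(fx l); exact: iter_contraction.
have le_step l :
    norm1 (iter l f y - iter l.+1 f y) <= xi ^+ l * norm1 (y - f y).
  (* The orbit shifted by one step is the orbit of [f y], so two orbits are compared. *)
  by rewrite iterSr; exact: iter_contraction.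
split=> [|l].
  apply: (squeeze_cvgr (f := fun=> 0) (h := geometric (norm1 (y - x)) xi)).
  - by near=> l; rewrite norm1_ge0/= mulrC le_x.
  - exact: cvg_cst.
  - by apply: cvg_geometric; rewrite ger0_norm.
split=> //; have := le_step l.
(* Both sides of the step estimate carry the positive factor [1 - xi], which cancels. *)
rewrite iterS /f !sub_elo_damped !norm1Z ger0_norm ?subr_ge0 ?(ltW xi1)//.
by rewrite mulrCA ler_pM2l// subr_gt0.
Unshelve. all: by end_near. Qed.
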